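(* Let $2\leq d\leq n-1$ and let $D$ be a simple strongly connected digraph on $n$ vertices with clique number $d$. Then $q(D)\geq q(B_{n,d})$, with equality if and only if $D\cong B_{n,d}$.
   Context: Digraphs are finite and simple (no loops, no multiple arcs). $q(D)$ is the spectral radius of the signless Laplacian matrix $Q(D)=\mathrm{diag}(d_1^+,\ldots,d_n^+)+A(D)$, where $d_i^+$ is the outdegree of vertex $i$ and $A(D)$ is the adjacency matrix. The complete digraph on $d$ vertices has both arcs $(i,j),(j,i)$ for every pair of distinct vertices. The clique number of $D$ is the maximum number of vertices in a vertex set inducing a complete subdigraph of $D$ (a single vertex counts as complete). For $2\leq d\leq n-1$, $B_{n,d}$ is the digraph with vertex set $\{u_1,\ldots,u_n\}$ obtained by taking a complete digraph on the $d$ vertices $u_1,u_{n-d+2},u_{n-d+3},\ldots,u_n$ and adding the directed path $u_1\to u_2\to\cdots\to u_{n-d+1}\to u_{n-d+2}$, which meets the complete digraph exactly in $u_1$ and $u_{n-d+2}$. *)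

(* Defs.v *)
From mathcomp Require Import all_boot all_order all_algebra.
From mathcomp Require Import boolp classical_sets reals complex.

Set Implicit Arguments.
Unset Strict Implicit.
Unset Printing Implicit Defensive.

Import Order.TTheory GRing.Theory Num.Theory.
Local Open Scope classical_set_scope.
Local Open Scope ring_scope.

(* A simple digraph on n vertices is an irreflexive relation e on 'I_n, with
   e u v meaning that (u, v) is an arc; irreflexivity is assumed separately. *)

Definition strongly_connected (T : finType) (e : rel T) : Prop :=
  forall u v : T, connect e u v.

Definition is_clique (T : finType) (e : rel T) (S : {set T}) : bool :=
  [forall u in S, forall v in S, (u != v) ==> e u v].

Definition clique_number (T : finType) (e : rel T) : nat :=
  (\max_(S : {set T} | is_clique e S) #|S|)%N.

Definition digraph_iso (T1 T2 : finType) (e1 : rel T1) (e2 : rel T2) : Prop :=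
  exists2 f : T1 -> T2, bijective f & forall u v, e1 u v = e2 (f u) (f v).

Definition outdegree (T : finType) (e : rel T) (u : T) : nat :=
  #|[set v | e u v]%SET|.

Definition adjacency_mx (R : realType) (n : nat) (e : rel 'I_n) : 'M[R]_n :=
  \matrix_(i, j) (e i j)%:R.

Definition signless_laplacian (R : realType) (n : nat) (e : rel 'I_n) :
    'M[R]_n :=
  diag_mx (\row_i (outdegree e i)%:R) + adjacency_mx R e.

(* The eigenvalues are the complex ones.  There are finitely many of them, so
   the supremum is a maximum (when 0 < n). *)
Definition spectral_radius (R : realType) (n : nat) (A : 'M[R]_n) : R :=
  sup [set ComplexField.Normc.normc z
      | z in [set z : R[i] | eigenvalue (map_mx (real_complex R) A) z]].

Definition q (R : realType) (n : nat) (e : rel 'I_n) : R :=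
  spectral_radius (signless_laplacian R e).

(* The vertex u_k of B_{n,d} (1 <= k <= n) is the ordinal k - 1, so the
   vertices of the complete subdigraph are 0 and n - d + 1, ..., n - 1. *)
Definition in_BK (n d : nat) (u : 'I_n) : bool :=
  (u == 0 :> nat)%N || (n - d + 1 <= u)%N.

Definition B (n d : nat) : rel 'I_n := fun u v =>
  [&& u != v, in_BK d u & in_BK d v]
  || ((u <= n - d)%N && (v == u.+1 :> nat)).

(* Main.v *)
Require Import Defs.
From mathcomp Require Import all_boot all_order all_algebra.
From mathcomp Require Import boolp classical_sets reals complex.
From mathcomp Require Import topology normedtype derive.
From mathcomp Require Import ring lra zify.
Import Order.TTheory GRing.Theory Num.Theory.
Import ComplexField.Normc numFieldNormedType.Exports.
Local Open Scope ring_scope.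

(* Let r = q(B_{n,d}) with positive eigenvector X, where X_k stands at u_{k+1},
   and put m = n - d.  Along the path (r - 1) X_k = X_{k+1}, X takes one value y
   on the clique minus u_1, and X_1 < ... < X_m < y < X_0.  Given D with a clique
   K of order d, choose an arc from some w in K to a vertex outside K.  Put X_0
   at w, y on the rest of K, and X_{m+1-h} at a vertex at distance h > 0 to K;
   such distances are at most m.  Keeping at every vertex only the arcs into
   the clique, the arc w -> v1, or one arc that decreases the distance, this
   positive vector z already satisfies Q(D) z >= r z, so q(D) >= r by
   Perron-Frobenius.  In case of equality Q(D) z = r z, so no arc was dropped,
   v1 is at distance m and the path from v1 to K exhausts the complement of K
   and ends away from w; hence D is B_{n,d}. *)

Set Implicit Arguments.
Unset Strict Implicit.
Unset Printing Implicit Defensive.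

(** * Perron-Frobenius theory of irreducible nonnegative matrices *)

Lemma normc_ge0 (R : rcfType) (z : R[i]) : 0 <= normc z.
Proof. by case: z => a b; exact: sqrtr_ge0. Qed.

Lemma normc_real (R : rcfType) (a : R) : normc (real_complex R a) = `|a|.
Proof. by rewrite /normc /= expr0n addr0 sqrtr_sqr. Qed.

Lemma ler_normc_sum (R : rcfType) (n : nat) (F : 'I_n -> R[i]) :
  normc (\sum_i F i) <= \sum_i normc (F i).
Proof.
elim/big_ind2: _ => [|a a' b b' ha hb|//]; first by rewrite normc0.
by apply: le_trans (le_normcD _ _) _; apply: lerD.
Qed.

(** For a left eigenvector v with eigenvalue z, taking absolute values gives |z| |v_j| <= sum_i
    |v_i| A_ij; pairing with the positive vector x yields |z| <= r. As r is itself an eigenvalue,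
    the supremum is attained there. *)
Lemma spectral_radius_perron (R : realType) (n : nat) (A : 'M[R]_n)
    (x : 'cV[R]_n) (r : R) :
  (0 < n)%N -> (forall i j, 0 <= A i j) -> (forall i, 0 < x i 0) ->
  A *m x = r *: x -> spectral_radius A = r.
Proof.
case: n A x => // n A x _ A0 x0 Ax.
have Axi i : \sum_j A i j * x j 0 = r * x i 0.
  by have := congr1 (fun B : 'cV_n.+1 => B i 0) Ax; rewrite !mxE.
have r0 : 0 <= r.
  rewrite -(pmulr_lge0 _ (x0 ord0)) -Axi.
  by apply: sumr_ge0 => j _; rewrite mulr_ge0 // ltW.
(* Eigenvectors are row vectors in MathComp, hence the detour through A^T. *)
have eig : eigenvalue (map_mx (real_complex R) A) (real_complex R r).
  rewrite eigenvalue_root_char -map_char_poly fmorph_root.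
  have -> : char_poly A = char_poly A^T.
    rewrite /char_poly -det_tr; congr (\det _).
    by apply/matrixP=> i j; rewrite !mxE eq_sym.
  rewrite -eigenvalue_root_char; apply/eigenvalueP; exists x^T.
    by rewrite -trmx_mul Ax linearZ.
  apply/eqP => /matrixP /(_ 0 ord0); rewrite !mxE => /eqP.
  by rewrite gt_eqF.
rewrite /spectral_radius; set S := image _ _.
have ubS : ubound S r.
  move=> _ [z /= /eigenvalueP [v vA v0] <-].
  pose m i := normc (v 0 i).
  have m0 i : 0 <= m i by exact: normc_ge0.
  have mA j : normc z * m j <= \sum_i m i * A i j.
    have := congr1 (fun B : 'rV_n.+1 => B 0 j) vA; rewrite !mxE => E.
    rewrite -normcM -E.
    apply: le_trans (ler_normc_sum _) _; apply: ler_sum => i _.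
    rewrite normcM mxE ler_wpM2l ?normc_ge0 //.
    by rewrite normc_real ger0_norm.
  have pos : 0 < \sum_j m j * x j 0.
    have [j vj] : exists j, v 0 j != 0.
      apply/existsP; apply: contraR v0; rewrite negb_exists => /forallP H.
      by apply/eqP/rowP => j; rewrite mxE; have := H j; rewrite negbK => /eqP.
    rewrite (bigD1 j) //= ltr_pwDl //.
      rewrite mulr_gt0 // lt_def m0 andbT.
      by apply: contraNneq vj => /eq0_normc ->.
    by apply: sumr_ge0 => i _; rewrite mulr_ge0 // ltW.
  rewrite -(ler_pM2r pos) mulr_sumr.
  apply: (@le_trans _ _ (\sum_j (\sum_i m i * A i j) * x j 0)).
    by apply: ler_sum => j _; rewrite mulrA ler_wpM2r // ltW.
  rewrite mulr_sumr; under eq_bigr do rewrite mulr_suml.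
  rewrite exchange_big /=; apply: ler_sum => i _.
  rewrite mulrCA -Axi mulr_sumr; apply: ler_sum => j _.
  by rewrite mulrA.
have Sr : S r.
  exists (real_complex R r) => //.
  by rewrite normc_real ger0_norm.
apply/eqP; rewrite eq_le; apply/andP; split.
- by apply: sup_le_ub => //; exists r.
- by apply: ub_le_sup => //; exists r.
Qed.

(** Collatz-Wielandt condition: for nonnegative A the largest t allowed by u is the minimum of (A
    u)_i / u_i over the i with u_i != 0. The form without division admits zero coordinates. *)
Definition feasible (R : realType) (n : nat) (A : 'M[R]_n) (t : R)
    (u : 'cV[R]_n) : Prop :=
  [/\ forall i, 0 <= u i 0, u != 0 & forall i, t * u i 0 <= (A *m u) i 0].

Lemma feasible_sum_gt0 (R : realType) (n : nat) (u : 'cV[R]_n) :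
  (forall i, 0 <= u i 0) -> u != 0 -> 0 < \sum_i u i 0.
Proof.
move=> u0 un0; rewrite lt_def sumr_ge0 // andbT.
apply: contra un0; rewrite psumr_eq0 // => /allP H.
apply/eqP/colP => i; rewrite mxE; apply/eqP.
exact: (H i (mem_index_enum i)).
Qed.

Lemma continuous_sum_ord (T : topologicalType) (R : realType) (n : nat)
    (f : 'I_n -> T -> R) :
  (forall i, continuous (f i)) -> continuous (fun w => \sum_i f i w).
Proof.
move=> cf.
have -> : (fun w => \sum_i f i w)
    = \big[(fun g h w => g w + h w)/(fun=> 0)]_i f i.
  by apply/funext => w; elim/big_rec2: _ => [//|i a b _ ->].
elim/big_ind: _ => [|g h cg ch|i _]; last exact: cf.
- exact: cst_continuous.
- by move=> w; apply: continuousD; [exact: cg | exact: ch].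
Qed.

Lemma closed_le_fun (T : topologicalType) (R : realType) (f g : T -> R) :
  continuous f -> continuous g -> closed [set w | f w <= g w]%classic.
Proof.
move=> cf cg.
have -> : [set w | f w <= g w]%classic = ((fun w => g w - f w) @^-1` [set x | 0 <= x])%classic.
  by apply/seteqP; split => w /=; rewrite subr_ge0.
apply: preimage_closed; last exact: closed_ge.
by move=> w _; apply: continuousB; [exact: cg | exact: cf].
Qed.

Lemma closed_forall (T : topologicalType) (I : Type) (P : I -> T -> Prop) :
  (forall i, closed [set w | P i w]%classic) ->
  closed [set w | forall i, P i w]%classic.
Proof.
move=> cP.
have -> : [set w | forall i, P i w]%classic = (\bigcap_i [set w | P i w])%classic.
  by apply/seteqP; split => w /= H i => [_|]; exact: H.
by apply: closed_bigI => i _; exact: cP.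
Qed.

Lemma feasible_max (R : realType) (n : nat) (A : 'M[R]_n) (q0 : R)
    (u0 : 'cV[R]_n) :
  (forall i j, 0 <= A i j) -> feasible A q0 u0 ->
  exists t z, [/\ q0 <= t, feasible A t z &
    forall t' z', feasible A t' z' -> t' <= t].
Proof.
move=> A0 fu0.
(* Summing t z_j <= (A z)_j over j, where the z_i are at most 1 and have sum 1, bounds t by C. *)
pose C := \sum_j \sum_i A j i.
(* Coordinate 0 of w holds t and the others a vector z of sum 1, so that t is a
   continuous function of w, to be maximised over the compact set K. *)
pose K := [set w : 'rV[R]_n.+1 | [/\ q0 <= w 0 ord0,
  forall i, 0 <= w 0 (lift ord0 i), \sum_i w 0 (lift ord0 i) = 1 &
  forall j, w 0 ord0 * w 0 (lift ord0 j)
              <= \sum_i A j i * w 0 (lift ord0 i)]]%classic.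
have coordle (w : 'rV[R]_n.+1) i :
    (forall i, 0 <= w 0 (lift ord0 i)) -> \sum_i w 0 (lift ord0 i) = 1 ->
    w 0 (lift ord0 i) <= 1.
  move=> w0 <-; rewrite (bigD1 i) //= lerDl.
  by apply: sumr_ge0 => k _; exact: w0.
have KC w : K w -> w 0 ord0 <= C.
  move=> [_ w0 w1 wA]; rewrite -[w 0 ord0]mulr1 -w1 mulr_sumr.
  apply: ler_sum => j _; apply: le_trans (wA j) _; apply: ler_sum => i _.
  by rewrite ler_piMr // coordle.
have Kof t z : q0 <= t -> feasible A t z -> exists2 w, K w & w 0 ord0 = t.
  move=> qt [z0 zn0 zA]; have s0 := feasible_sum_gt0 z0 zn0.
  set s := \sum_i _ in s0.
  have si : 0 <= s^-1 by rewrite invr_ge0 ltW.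
  pose w : 'rV[R]_n.+1 :=
    \row_i (if unlift ord0 i is Some k then s^-1 * z k 0 else t).
  have w0 : w 0 ord0 = t by rewrite mxE unlift_none.
  have wl k : w 0 (lift ord0 k) = s^-1 * z k 0 by rewrite mxE liftK.
  exists w => //; split; rewrite ?w0 //.
  - by move=> i; rewrite wl mulr_ge0.
  - under eq_bigr do rewrite wl.
    by rewrite -mulr_sumr mulVf // gt_eqF.
  - move=> j; under eq_bigr do rewrite wl mulrCA.
    rewrite wl mulrCA -mulr_sumr ler_wpM2l //.
    by have := zA j; rewrite mxE.
have cc (i : 'I_n.+1) : continuous (fun w : 'rV[R]_n.+1 => w 0 i).
  exact: coord_continuous.
have cK : compact K.
  pose box (i : 'I_n.+1) : set R :=
    if unlift ord0 i is Some _ then `[0, 1]%classic else `[q0, C]%classic.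
  apply: (@subclosed_compact _ K
    [set v : 'rV[R]_n.+1 | forall i, box i (v ord0 i)]%classic).
  - have -> : K = ([set w | q0 <= w 0 ord0]
       `&` [set w | forall i, 0 <= w 0 (lift ord0 i)]
       `&` ([set w | \sum_i w 0 (lift ord0 i) <= 1]
       `&` [set w | 1 <= \sum_i w 0 (lift ord0 i)])
       `&` [set w | forall j, w 0 ord0 * w 0 (lift ord0 j)
              <= \sum_i A j i * w 0 (lift ord0 i)])%classic.
      apply/seteqP; split => w /= [].
        by move=> ? ? -> ?; rewrite lexx.
      move=> [[a b] [c e] f]; split => //.
      by apply/eqP; rewrite eq_le c e.
    have csum : continuous (fun w : 'rV[R]_n.+1 => \sum_i w 0 (lift ord0 i)).
      exact: continuous_sum_ord.
    have ccst c : continuous (fun w : 'rV[R]_n.+1 => c : R).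
      exact: cst_continuous.
    repeat apply: closedI; try apply: closed_forall => i; apply: closed_le_fun => //.
    + by move=> w; apply: continuousM; exact: cc.
    + apply: continuous_sum_ord => k w.
      by apply: continuousM; [exact: ccst | exact: cc].
  - apply: rV_compact => i; rewrite /box.
    by case: unliftP => [k _|_]; exact: segment_compact.
  - move=> w Kw i; have [a b c _] := Kw; rewrite /box.
    case: unliftP => [k ->|->] /=; rewrite in_itv /=.
      by rewrite b coordle.
    by rewrite a KC.
have [w0 Kw0 _] := Kof q0 u0 (lexx _) fu0.
have [||w /set_mem Kw wmax] := @EVT_max_rV R n.+1 (fun w => w 0 ord0) K _ cK.
- by exists w0.
- exact/continuous_subspaceT/cc.
have [a b c e] := Kw.
exists (w 0 ord0), (\col_i w 0 (lift ord0 i)); split => //.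
- split.
  + by move=> i; rewrite mxE.
  + apply/eqP => /colP H; have := c; rewrite big1 ?(oner_eq0) //.
      by move/esym/eqP; rewrite oner_eq0.
    by move=> i _; have := H i; rewrite !mxE.
  + move=> j; rewrite !mxE; apply: le_trans (e j) _.
    by apply: ler_sum => i _; rewrite mxE.
(* K only sees values t >= q0; a smaller t' lies below the maximum anyway. *)
- move=> t' z' f'; case: (leP t' q0) => [h|h]; first exact: le_trans h a.
  have [w' Kw' <-] := Kof t' z' (ltW h) f'.
  by apply: wmax; apply/mem_set.
Qed.

(** A path from i to j without repeated vertices has some length k < n and makes the (i, j) entry of
    [A ^+ k] positive; k = 0 covers the diagonal. *)
Lemma power_sum_gt0 (R : realType) (n : nat) (A : 'M[R]_n) (e : rel 'I_n) :
  (forall i j, 0 <= A i j) -> (forall i j, e i j -> 0 < A i j) ->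
  strongly_connected e ->
  forall i j, 0 < (\sum_(k < n) A ^+ k) i j.
Proof.
move=> A0 Ae sc.
have pow0 k i j : 0 <= (A ^+ k) i j.
  elim: k i j => [|k IH] i j; first by rewrite expr0 mxE; case: eqP.
  by rewrite exprS mxE sumr_ge0 // => l _; rewrite mulr_ge0.
have powp p i : path e i p -> 0 < (A ^+ size p) i (last i p).
  elim: p i => [|l p IH] i /=; first by rewrite expr0 mxE eqxx.
  move=> /andP[il pp]; rewrite exprS mxE (bigD1 l) //= ltr_pwDl //.
    by rewrite mulr_gt0 ?Ae ?IH.
  by apply: sumr_ge0 => k _; rewrite mulr_ge0.
move=> i j; have /connectP[p0 pp0 ->] := sc i j.
have [p pp up _] := shortenP pp0.
have sp : (size p < n)%N.
  by have := max_card (mem (i :: p)); rewrite (card_uniqP up) card_ord.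
rewrite summxE (bigD1 (Ordinal sp)) //= ltr_pwDl ?powp //.
by apply: sumr_ge0.
Qed.

Lemma mulmx_gt0 (R : realType) (n : nat) (P : 'M[R]_n) (u : 'cV[R]_n) :
  (forall i j, 0 < P i j) -> (forall i, 0 <= u i 0) -> u != 0 ->
  forall i, 0 < (P *m u) i 0.
Proof.
move=> P0 u0 un0 i.
have /existsP[j uj] : [exists j, u j 0 != 0].
  apply: contraR un0; rewrite negb_exists => /forallP H.
  by apply/eqP/colP => j; rewrite mxE; have := H j; rewrite negbK => /eqP.
rewrite mxE (bigD1 j) //= ltr_pwDl //.
  by rewrite mulr_gt0 // lt_def uj u0.
by apply: sumr_ge0 => k _; rewrite mulr_ge0 // ltW.
Qed.

(* Multiplication by the positive matrix P turns A u >= t u into a strict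
   inequality in every coordinate. *)
Lemma feasible_improve (R : realType) (n : nat) (A P : 'M[R]_n) (t : R)
    (u : 'cV[R]_n) :
  (forall i j, 0 < P i j) -> A *m P = P *m A ->
  feasible A t u -> A *m u != t *: u ->
  exists t' (u' : 'cV[R]_n), t < t' /\ feasible A t' u'.
Proof.
move=> P0 AP [u0 un0 uA] neq.
pose v := A *m u - t *: u.
have v0 i : 0 <= v i 0.
  have -> : v i 0 = (A *m u) i 0 - t * u i 0 by rewrite /v !mxE.
  by rewrite subr_ge0.
have vn0 : v != 0 by rewrite subr_eq0.
pose y := P *m u; pose w := P *m v.
have y0 : forall i, 0 < y i 0 by exact: mulmx_gt0.
have w0 : forall i, 0 < w i 0 by exact: mulmx_gt0.
have wE : w = A *m y - t *: y.
  by rewrite /w /v mulmxBr !mulmxA AP -scalemxAr.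
have n0 : exists i : 'I_n, true.
  case: n A P u un0 {y w y0 w0 wE v v0 vn0 P0 AP u0 uA neq} => [A P u|n *].
    by move/eqP; case; apply/colP => -[].
  by exists ord0.
have [i0 _] := n0.
(* The sum s dominates every ratio y_i / w_i, so y_i / s <= w_i in all coordinates at once and t can
   be raised by 1 / s. *)
pose s := \sum_i y i 0 / w i 0.
have yw i : 0 < y i 0 / w i 0 by rewrite divr_gt0.
have s0 : 0 < s.
  rewrite /s (bigD1 i0) //= ltr_pwDl //.
  by apply: sumr_ge0 => i _; exact: ltW.
exists (t + s^-1), y; split; first by rewrite ltrDl invr_gt0.
split=> [i||i]; first exact: ltW.
  by apply/eqP => /colP /(_ i0) /eqP; rewrite [X in _ == X]mxE gt_eqF.
have -> : (A *m y) i 0 = w i 0 + t * y i 0.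
  by rewrite wE !mxE subrK.
rewrite mulrDl addrC lerD2r ler_pdivrMl // -ler_pdivrMr //.
rewrite /s (bigD1 i) //= lerDl.
by apply: sumr_ge0 => j _; exact: ltW.
Qed.

(** A feasible pair with maximal value is an eigenpair, since [feasible_improve] would otherwise
    raise the value. The last clause serves the equality case. *)
Lemma perron_root_ge (R : realType) (n : nat) (A : 'M[R]_n) (e : rel 'I_n)
    (t : R) (u : 'cV[R]_n) :
  (forall i j, 0 <= A i j) -> (forall i j, e i j -> 0 < A i j) ->
  strongly_connected e -> feasible A t u ->
  exists r (x : 'cV[R]_n), [/\ t <= r, forall i, 0 < x i 0, A *m x = r *: x &
    A *m u != t *: u -> t < r].
Proof.
move=> A0 Ae sc fu.
pose P := \sum_(k < n) A ^+ k.
have P0 : forall i j, 0 < P i j by exact: power_sum_gt0 Ae sc.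
have AP : A *m P = P *m A.
  rewrite /P mulmx_sumr mulmx_suml; apply: eq_bigr => k _.
  by rewrite -[LHS]exprS -[RHS]exprSr.
have [r [x [tr [x0 xn0 xA] rmax]]] := feasible_max A0 fu.
have Ax : A *m x = r *: x.
  apply/eqP/negPn/negP => /(feasible_improve P0 AP (And3 x0 xn0 xA)).
  by move=> [t' [u' [lt /rmax]]]; rewrite leNgt lt.
exists r, x; split => //.
  move=> i; rewrite lt_def x0 andbT; apply: contraTneq isT => xi.
  have := mulmx_gt0 P0 x0 xn0 i.
  (* P acts on x as a scalar, so a zero coordinate of x would survive in the positive vector P x. *)
  have -> : P *m x = (\sum_(k < n) r ^+ k) *: x.
    rewrite /P mulmx_suml scaler_suml; apply: eq_bigr => k _.
    elim: (nat_of_ord k) => [|m IH]; first by rewrite !expr0 mul1mx scale1r.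
    by rewrite exprSr -mulmxA Ax -scalemxAr IH scalerA exprS.
  by rewrite mxE xi mulr0 ltxx.
move=> /(feasible_improve P0 AP fu) [t' [u' [lt /rmax]]].
exact: lt_le_trans.
Qed.

(** * The signless Laplacian and the Perron vector of B_{n,d} *)

Lemma signless_laplacian_ge0 (R : realType) (n : nat) (e : rel 'I_n) i j :
  0 <= signless_laplacian R e i j.
Proof. by rewrite !mxE addr_ge0 // mulrn_wge0. Qed.

Lemma signless_laplacian_gt0 (R : realType) (n : nat) (e : rel 'I_n) i j :
  e i j -> 0 < signless_laplacian R e i j.
Proof. by move=> eij; rewrite !mxE eij ltr_wpDl // mulrn_wge0. Qed.

(** With one summand u_i + u_j per arc i -> j, the effect of dropping arcs can be read off
    directly. *)
Lemma signless_laplacian_mul (R : realType) (n : nat) (e : rel 'I_n)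
    (u : 'cV[R]_n) i :
  (signless_laplacian R e *m u) i 0 = \sum_(j | e i j) (u i 0 + u j 0).
Proof.
rewrite mulmxDl mxE mul_diag_mx !mxE big_split /= sumr_const mulr_natl.
congr (_ *+ _ + _); first by rewrite /outdegree cardsE.
by rewrite [RHS]big_mkcond; apply: eq_bigr => j _; rewrite mxE; case: (e i j);
  rewrite ?mul1r ?mul0r.
Qed.

Lemma q_perron (R : realType) (n : nat) (e : rel 'I_n) :
  (0 < n)%N -> strongly_connected e ->
  exists2 x : 'cV[R]_n, forall i, 0 < x i 0 &
    signless_laplacian R e *m x = q R e *: x.
Proof.
move=> n0 sc.
have fu : feasible (signless_laplacian R e) 0 (const_mx 1).
  case: n n0 e sc => // n _ e sc; split.
  - by move=> i; rewrite mxE ler01.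
  - by apply/eqP => /colP /(_ ord0) /eqP; rewrite !mxE oner_eq0.
  - move=> i; rewrite mul0r signless_laplacian_mul; apply: sumr_ge0 => j _.
    by rewrite !mxE addr_ge0 ?ler01.
have [|r [x [_ x0 xE _]]] := perron_root_ge _ (@signless_laplacian_gt0 R n e) sc fu.
  exact: signless_laplacian_ge0.
exists x => //; rewrite /q (spectral_radius_perron n0 _ x0 xE) //.
exact: signless_laplacian_ge0.
Qed.

Lemma q_ge (R : realType) (n : nat) (e : rel 'I_n) (t : R) (u : 'cV[R]_n) :
  (0 < n)%N -> strongly_connected e ->
  feasible (signless_laplacian R e) t u ->
  t <= q R e /\ (q R e = t -> signless_laplacian R e *m u = t *: u).
Proof.
move=> n0 sc fu.
have A0 := @signless_laplacian_ge0 R n e.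
have [r [x [tr x0 xE st]]] := perron_root_ge A0 (@signless_laplacian_gt0 R n e) sc fu.
rewrite /q (spectral_radius_perron n0 A0 x0 xE); split=> // rt.
by apply/eqP/negPn/negP => /st; rewrite rt ltxx.
Qed.

(** A positive eigenvector for [e2], pulled back along f, is one for [e1] with the same eigenvalue,
    and a positive eigenvector determines the spectral radius. *)
Lemma q_iso (R : realType) (n : nat) (e1 e2 : rel 'I_n) :
  (0 < n)%N -> strongly_connected e2 -> digraph_iso e1 e2 -> q R e1 = q R e2.
Proof.
move=> n0 sc [f bf ef]; have [x x0 xE] := q_perron R n0 sc.
apply: (@spectral_radius_perron _ _ _ (\col_i x (f i) 0)) => //.
- exact: signless_laplacian_ge0.
- by move=> i; rewrite mxE.
apply/colP => i; rewrite signless_laplacian_mul.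
have := congr1 (fun M : 'cV_n => M (f i) 0) xE.
rewrite signless_laplacian_mul !mxE => <-.
rewrite [RHS](reindex f) /=; last exact: onW_bij.
by apply: eq_big => j; rewrite ?ef // !mxE.
Qed.

(** This is the contribution of the clique arcs at v. Of the |K| - 1 copies of f v, one completes
    the sum of the f j to all of K. *)
Lemma sum_clique (R : realType) (T : finType) (K : {set T}) (v : T)
    (f : T -> R) :
  v \in K ->
  \sum_(j in K | j != v) (f v + f j) = (#|K|%:R - 2) * f v + \sum_(j in K) f j.
Proof.
move=> vK; rewrite big_split /= sumr_const [in RHS](bigD1 v) //=.
have -> : #|[pred j in K | j != v]| = #|K|.-1.
  by rewrite (cardD1 v) vK add1n /=; apply: eq_card => j; rewrite !inE andbC.
have : (0 < #|K|)%N by apply/card_gt0P; exists v.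
by case: #|K| => // m _; rewrite /= -mulr_natr -addn1 natrD; ring.
Qed.

Lemma sum_one_exception (R : realType) (T : finType) (K : {set T}) (w : T)
    (f : T -> R) (y : R) :
  w \in K -> (forall j, j \in K -> j != w -> f j = y) ->
  \sum_(j in K) f j = f w + (#|K|%:R - 1) * y.
Proof.
move=> wK fy; rewrite (bigD1 w) //=; congr (_ + _).
under eq_bigr => j /andP[jK jw] do rewrite fy //.
rewrite sumr_const.
have -> : #|[pred j in K | j != w]| = #|K|.-1.
  by rewrite (cardD1 w K) wK add1n; apply: eq_card => j; rewrite !inE andbC.
have K0 : (0 < #|K|)%N by apply/card_gt0P; exists w.
have -> : #|K|%:R - 1 = #|K|.-1%:R :> R by rewrite -subn1 natrB.
by rewrite mulr_natl.
Qed.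

(** The vertex u_1 is a hub: it is reached by climbing the path into the clique, and it reaches the
    others along the path or by one clique arc. *)
Lemma B_strongly_connected (n d : nat) :
  (2 <= d)%N -> (d <= n - 1)%N -> strongly_connected (@B n d).
Proof.
move=> d2 dn; case: n dn => [|n] dn; first by lia.
have to0 (u : 'I_n.+1) : connect (@B n.+1 d) u ord0.
  have [k] := ubnP (n.+1 - u); elim: k u => // k IH u uk.
  have [->//|u0] := eqVneq u ord0.
  have [un|un] := leqP u (n.+1 - d).
    have su : (u.+1 < n.+1)%N by lia.
    apply: (@connect_trans _ _ (Ordinal su)); last by apply: IH => /=; lia.
    by apply: connect1; rewrite /B /= eqxx un orbT.
  by apply: connect1; rewrite /B u0 /in_BK /= addn1 un ?orbT.
have from0 (u : 'I_n.+1) : connect (@B n.+1 d) ord0 u.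
  case: u => u; elim: u => [|u IH] lu; first by apply: eq_connect0; apply: val_inj.
  have [un|un] := leqP u (n.+1 - d).
    have su : (u < n.+1)%N by lia.
    apply: (connect_trans (IH su)).
    by apply: connect1; rewrite /B /= eqxx un orbT.
  by apply: connect1; rewrite /B /in_BK /= addn1 (leqW un) ?orbT.
by move=> u v; apply: connect_trans (to0 u) (from0 v).
Qed.

Lemma card_in_BK (n d : nat) :
  (0 < d)%N -> (d <= n - 1)%N -> #|[set u : 'I_n | in_BK d u]| = d.
Proof.
case: n => [|n] d0 dn; first by lia.
have -> : [set u : 'I_n.+1 | in_BK d u]
    = ord0 |: [set u : 'I_n.+1 | (n.+1 - d + 1 <= u)%N].
  by apply/setP => u; rewrite !inE /in_BK.
rewrite cardsU1 inE /= addn1 ltn0 -sum1_card.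
under eq_bigl do rewrite inE.
by rewrite -(big_geq_mkord _ _ xpredT (fun=> 1%N)) sum_nat_const_nat; lia.
Qed.

(** Index n - d + 1 belongs to u_{n-d+2}, where the path enters the clique, so the path equation at
    k = n - d involves y. *)
Lemma B_perron (R : realType) (n d : nat) :
  (2 <= d)%N -> (d <= n - 1)%N ->
  let r := q R (@B n d) in
  exists (X : nat -> R), let y := X (n - d + 1)%N in
  [/\ forall k, 0 < X k,
      forall k, (0 < k <= n - d)%N -> r * X k = X k + X k.+1 /\ X k < X k.+1,
      y < X 0%N,
      r * y = (d%:R - 2) * y + (X 0%N + (d%:R - 1) * y) &
      r * X 0%N = (d%:R - 2) * X 0%N + (X 0%N + (d%:R - 1) * y)
                  + (X 0%N + X 1%N)].
Proof.
move=> d2 dn; case: n dn => [|n] dn; first by lia.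
have [x x0 xE] := q_perron R (ltn0Sn n) (B_strongly_connected d2 dn).
move: xE; set r := q _ _ => xE /=.
have E i : \sum_(j | @B n.+1 d i j) (x i 0 + x j 0) = r * x i 0.
  by rewrite -signless_laplacian_mul xE mxE.
pose K := [set u : 'I_n.+1 | in_BK d u].
have cK : #|K| = d by apply: card_in_BK => //; lia.
pose S := \sum_(j in K) x j 0.
have K0 : ord0 \in K by rewrite inE.
have EK i : i \in K -> i != ord0 -> r * x i 0 = (d%:R - 2) * x i 0 + S.
  move=> iK i0; have := sum_clique (fun j => x j 0) iK; rewrite cK -/S => <-.
  rewrite -E; apply: eq_bigl => j; move: iK i0.
  rewrite !inE /B /in_BK -!val_eqE /= => iK i0.
  by rewrite iK andTb [j == i :> nat]eq_sym; lia.
(* [inord] sends an index out of range to 0, so X is positive on all of [nat]. *)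
pose X k := x (inord k) 0.
pose y := X (n.+1 - d + 1)%N.
have yn : (n.+1 - d + 1 < n.+1)%N by lia.
have y0 : 0 < y by exact: x0.
(* All these vertices satisfy (r - d + 2) x_i = S with S > 0; hence r - d + 2 > 0 and the value is
   unique. *)
have Kx i : i \in K -> i != ord0 -> x i 0 = y.
  move=> iK i0.
  have jK : inord (n.+1 - d + 1) \in K by rewrite inE /in_BK inordK // leqnn orbT.
  have j0 : inord (n.+1 - d + 1) != ord0 :> 'I_n.+1.
    by rewrite -val_eqE /= inordK // addn1.
  have Ei := EK i iK i0; have Ej := EK _ jK j0.
  have S0 : 0 < S.
    by rewrite /S (bigD1 i) //= ltr_pwDl // sumr_ge0 // => l _; exact: ltW.
  have rn0 : 0 < r - d%:R + 2.
    by rewrite -(pmulr_lgt0 _ (x0 i)); move: S0; lra.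
  apply: (mulfI (lt0r_neq0 rn0)); rewrite /y /X; move: Ei Ej; lra.
have SE : S = X 0%N + (d%:R - 1) * y.
  have X0 : inord 0 = ord0 :> 'I_n.+1 by apply: val_inj; rewrite /= inordK.
  by rewrite /S (sum_one_exception K0 Kx) /X X0 cK.
exists X.
have EX0 : r * X 0%N = (d%:R - 2) * X 0%N + S + (X 0%N + X 1%N).
  have X0 : inord 0 = ord0 :> 'I_n.+1 by apply: val_inj; rewrite /= inordK.
  have l1 : (1 < n.+1)%N by lia.
  rewrite /X X0 -E (bigD1 (inord 1)) /=; last first.
    by rewrite /B /in_BK -val_eqE /= inordK //; lia.
  have := sum_clique (fun j => x j 0) K0; rewrite cK -/S => <-.
  rewrite addrC; congr (_ + _); apply: eq_bigl => j.
  by rewrite !inE /B /in_BK -!val_eqE /= inordK //; lia.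
have Ey : r * y = (d%:R - 2) * y + S.
  apply: EK; first by rewrite inE /in_BK inordK // leqnn orbT.
  by rewrite -val_eqE /= inordK // addn1.
have d2' : 2 <= d%:R :> R by rewrite ler_nat.
have Xp k : 0 < X k by exact: x0.
(* Subtracting [Ey] from [EX0] gives (r - d + 2) (X_0 - y) = X_0 + X_1 > 0. *)
have yX : y < X 0%N.
  have rn0 : 0 < r - d%:R + 2.
    rewrite -(pmulr_lgt0 _ y0); have := Xp 0%N; move: Ey; rewrite SE.
    have : 0 <= (d%:R - 1) * y by apply: mulr_ge0; [lra | exact: ltW].
    by lra.
  rewrite -subr_gt0 -(pmulr_rgt0 _ rn0).
  by have := Xp 0%N; have := Xp 1%N; move: EX0 Ey; lra.
(* Since X_0 > y, (r - d + 2) y = X_0 + (d - 1) y > d y, so r > 2 d - 2 >= 2. Then X_{k+1} = (r - 1)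
   X_k > X_k along the path. *)
have r2 : 2 < r.
  have : d%:R * y < (r - d%:R + 2) * y by move: Ey; rewrite SE; lra.
  by rewrite ltr_pM2r //; lra.
split=> //; last 2 first.
- by rewrite -SE.
- by rewrite -SE.
move=> k /andP[k0 kn].
have lk : (k < n.+1)%N by lia.
have lk1 : (k.+1 < n.+1)%N by lia.
have rX : r * X k = X k + X k.+1.
  rewrite /X -E (big_pred1 (inord k.+1)) // => j.
  by rewrite /B /in_BK /= -!val_eqE /= !inordK //; lia.
split=> //.
have : 0 < (r - 2) * X k by rewrite mulr_gt0 ?subr_gt0.
by move: rX; lra.
Qed.

(** * Structure of digraphs with a clique *)

(** h v is the least length of a walk from v to K, and the first step of such a walk leads one
    closer. Walks of length k are tuples, so their existence is decidable, as [ex_minn] requires. *)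
Lemma dist_to_set (T : finType) (e : rel T) (K : {set T}) :
  (forall v, exists2 u, u \in K & connect e v u) ->
  exists h : T -> nat, (forall v, (h v == 0%N) = (v \in K)) /\
    forall v, v \notin K -> exists2 u, e v u & h v = (h u).+1.
Proof.
move=> reach.
pose P v k := [exists p : k.-tuple T, path e v p && (last v p \in K)].
have exP v : exists k, P v k.
  have [u uK /connectP[p ep lp]] := reach v.
  by exists (size p); apply/existsP; exists (in_tuple p); rewrite ep -lp uK.
pose h v := ex_minn (exP v).
have hP v : P v (h v) by rewrite /h; case: ex_minnP.
have hmin v k : P v k -> (h v <= k)%N by rewrite /h; case: ex_minnP => m _; apply.
have h0 v : (h v == 0%N) = (v \in K).
  apply/eqP/idP => [hv|vK].
    by have := hP v; rewrite hv => /existsP[p]; rewrite tuple0 /=.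
  by apply/eqP; rewrite -leqn0; apply: hmin; apply/existsP; exists [tuple].
exists h; split=> // v vK.
case E: (h v) => [|k]; first by move: vK; rewrite -h0 E.
have := hP v; rewrite E => /existsP[p]; case/tupleP: p => u p /= /andP[/andP[vu pu] lK].
exists u => //; congr _.+1; apply/eqP; rewrite eqn_leq; apply/andP; split.
  rewrite -ltnS -E; have /existsP[p' /andP[ep' lp']] := hP u.
  by apply: hmin; apply/existsP; exists [tuple of u :: p']; rewrite /= vu ep'.
by apply: hmin; apply/existsP; exists p; rewrite pu.
Qed.

(** Descending from v one level at a time meets each value 1, ..., h v at some vertex outside K. *)
Lemma dist_le_card (T : finType) (K : {set T}) (h : T -> nat) :
  (forall v, (h v == 0%N) = (v \in K)) ->
  (forall v, v \notin K -> exists u, h v = (h u).+1) ->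
  forall v, (h v <= #|~: K|)%N.
Proof.
move=> h0 hS v.
have down k : forall v, (k <= h v)%N -> exists u, h u = k.
  move=> u; have [m] := ubnP (h u); elim: m u => // m IH u um.
  rewrite leq_eqVlt => /orP[/eqP ->|ku]; first by exists u.
  have uK : u \notin K by rewrite -h0; lia.
  have [u' hu] := hS u uK.
  by apply: (IH u'); lia.
rewrite -(size_iota 1 (h v)) cardE -(size_map h).
apply: uniq_leq_size; first exact: iota_uniq.
move=> k; rewrite mem_iota => kh; have [|u hu] := down k v; first by lia.
by apply/mapP; exists u => //; rewrite mem_enum inE -h0; lia.
Qed.

Lemma max_clique (T : finType) (e : rel T) :
  exists2 K : {set T}, is_clique e K & #|K| = clique_number e.
Proof.
have [|K Kc E] := @eq_bigmax_cond _ [pred S | is_clique e S] (fun S : {set T} => #|S|).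
  apply/card_gt0P; exists finset.set0; rewrite inE.
  by apply/forallP => u; apply/implyP; rewrite finset.in_set0.
by exists K; rewrite -?E.
Qed.

(** On a path from w to v, take the first vertex outside K and its predecessor. *)
Lemma exit_arc (T : finType) (e : rel T) (K : {set T}) (w v : T) :
  strongly_connected e -> w \in K -> v \notin K ->
  exists a b, [/\ a \in K, b \notin K & e a b].
Proof.
move=> sc wK; have /connectP[p ep ->] := sc w v.
elim: p w wK ep => [|u p IH] w wK /=; first by rewrite wK.
move=> /andP[wu pu]; have [uK|uK] := boolP (u \in K); first exact: IH.
by move=> _; exists w, u.
Qed.

(** Meant for P the kept arcs and Q all arcs at a vertex: dropping a positive term lowers the sum
    strictly. *)
Lemma sum_sub_pred (R : realType) (T : finType) (P Q : pred T) (F : T -> R) :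
  (forall j, 0 < F j) -> (forall j, P j -> Q j) ->
  \sum_(j | P j) F j <= \sum_(j | Q j) F j /\
  (\sum_(j | Q j) F j <= \sum_(j | P j) F j -> forall j, Q j = P j).
Proof.
move=> F0 PQ; rewrite (bigID P Q) /=.
have -> : \sum_(j | Q j && P j) F j = \sum_(j | P j) F j.
  by apply: eq_bigl => j; case: (boolP (P j)) => [/PQ ->|]; rewrite ?andbF.
split; first by rewrite lerDl; apply: sumr_ge0 => j _; exact: ltW.
rewrite gerDl => le0 j; apply/idP/idP => [Qj|/PQ//].
apply: contraLR le0 => Pj; rewrite -ltNge (bigD1 j) /= ?Qj //.
by rewrite ltr_pwDl // sumr_ge0 // => i _; exact: ltW.
Qed.

(** Along the iterates of [phi] from [v1], h falls from n - d to 0 by steps of one. They thus run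
    through n - d vertices outside K, which is the whole complement, and then enter K at a vertex
    other than w. *)
Lemma B_iso (n d : nat) (D : rel 'I_n) (K : {set 'I_n}) (w v1 : 'I_n)
    (h : 'I_n -> nat) (phi : 'I_n -> 'I_n) :
  (2 <= d)%N -> (d <= n - 1)%N -> #|K| = d -> w \in K -> v1 \notin K ->
  (forall v, (h v == 0%N) = (v \in K)) -> h v1 = (n - d)%N ->
  (forall v, v \notin K ->
     [/\ h v = (h (phi v)).+1, phi v != w & forall j, D v j = (j == phi v)]) ->
  (forall v j, v \in K -> v != w -> D v j = (j \in K) && (j != v)) ->
  (forall j, D w j = (j \in K) && (j != w) || (j == v1)) ->
  digraph_iso D (@B n d).
Proof.
move=> d2 dn cK wK v1K h0 hv1 outK inK atw.
set m := (n - d)%N in hv1.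
have hp i : (i <= m)%N -> h (iter i phi v1) = (m - i)%N.
  elim: i => [|i IH] im; first by rewrite subn0.
  have hi := IH (ltnW im).
  have iK : iter i phi v1 \notin K by rewrite -h0 hi; lia.
  by have [hh _ _] := outK _ iK; rewrite iterS; lia.
have pK i : (i < m)%N -> iter i phi v1 \notin K.
  by move=> im; rewrite -h0 hp; lia.
pose u0 := iter m phi v1.
have u0K : u0 \in K by rewrite -h0 hp // subnn.
have u0w : u0 != w.
  rewrite /u0; have -> : m = m.-1.+1 by lia.
  by have [|_ ? _] := outK (iter m.-1 phi v1); first by apply: pK; lia.
pose K' := K :\ w :\ u0.
(* s lists the counterparts of u_1, ..., u_n: w, then the path from v1 to u0, then the rest
   of K in any order. *)
pose s := w :: traject phi v1 m.+1 ++ enum K'.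
have inT v : v \in traject phi v1 m.+1 -> v \in K -> v = u0.
  move=> /trajectP[i im ->] iK; have : ~~ (i < m)%N by apply: contraL iK; exact: pK.
  by move=> ?; have -> : i = m by lia.
(* Only the last term [u0] of the trajectory lies in K, so it repeats no earlier term; by
   [looping_uniq] the trajectory has no repetition at all. *)
have us : uniq s.
  rewrite /s cons_uniq cat_uniq mem_cat mem_enum !inE wK eqxx andbF orbF.
  rewrite enum_uniq andbT looping_uniq; apply/and3P; split.
  - by apply: contraNN u0w => /inT -> //.
  - apply/negP => /trajectP[i im E]; have := pK i im.
    by rewrite -E -/u0 u0K.
  - apply/hasPn => v; rewrite mem_enum !inE => /and3P[vu vw vK].
    by apply: contraNN vu => /inT -> //.
have cK' : size (enum K') = d.-2.
  have u0K1 : u0 \in K :\ w by rewrite !inE u0w.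
  have := cardsD1 w K; have := cardsD1 u0 (K :\ w).
  by rewrite -cardE u0K1 wK cK -/K' => ->; rewrite !add1n => ->.
have ss : size s = n by rewrite /= size_cat size_traject cK'; lia.
have sE k : nth w s k.+1 = if (k < m.+1)%N then iter k phi v1
    else nth w (enum K') (k - m.+1).
  rewrite -[LHS]/(nth w (traject phi v1 m.+1 ++ enum K') k) nth_cat size_traject.
  by case: ltnP => km; [rewrite (set_nth_default v1) ?size_traject ?nth_traject | ].
pose g (i : 'I_n) := nth w s i.
have gE (i j : 'I_n) : (g i == g j) = (i == j) by rewrite nth_uniq ?ss.
have g0 (i : 'I_n) : (i = 0 :> nat)%N -> g i = w by rewrite /g => ->.
have gp (i : 'I_n) : (0 < i <= m.+1)%N -> g i = iter i.-1 phi v1.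
  move=> im; rewrite /g; have -> : (i : nat) = i.-1.+1 by lia.
  by rewrite sE; case: ltnP => //; lia.
have gK' (i : 'I_n) : (m.+1 < i)%N -> g i \in K'.
  move=> im; rewrite /g; have -> : (i : nat) = i.-1.+1 by lia.
  rewrite sE; case: ltnP => [|_]; first by lia.
  by rewrite -mem_enum mem_nth // cK'; have := ltn_ord i; lia.
have gK (i : 'I_n) : (g i \in K) = in_BK d i.
  rewrite /in_BK -/m addn1; have [i0|i0] := posnP i; first by rewrite g0.
  have [im|im] := leqP i m.
    by rewrite gp; [rewrite (negbTE (pK _ _)); lia | lia].
  have [im'|im'] := leqP i m.+1; last first.
    by have := gK' i im'; rewrite !inE orbT => /and3P[].
  rewrite gp; last by lia.
  by have -> : i.-1 = m by lia.
(* Three cases: i = 0 stands for w, 1 <= i <= m for the vertices outside K, and i > m for the rest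
   of K. *)
have Dg (i j : 'I_n) : D (g i) (g j) = @B n d i j.
  rewrite /B -!gK -/m.
  have [i0|i0] := posnP i.
    rewrite (g0 i) // atw -{1}(g0 i) // gE wK andTb [j == i]eq_sym andbC i0 leq0n andTb.
    congr (_ || _).
    have l1 : (1 < n)%N by lia.
    have -> : v1 = g (Ordinal l1) by rewrite gp.
    by rewrite gE -val_eqE.
  have [im|im] := leqP i m.
    have iK : g i \notin K by rewrite gp; [apply: pK; lia | lia].
    have [_ _ ->] := outK _ iK.
    rewrite (negbTE iK) /= andbF orFb.
    have l1 : (i.+1 < n)%N by lia.
    have -> : phi (g i) = g (Ordinal l1).
      by rewrite !gp /=; [rewrite -iterS prednK | lia | lia].
    by rewrite gE -val_eqE.
  have iK : g i \in K by rewrite gK /in_BK -/m; lia.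
  rewrite inK //; first by rewrite gE iK andTb andFb orbF andbC eq_sym.
  have l0 : (0 < n)%N by lia.
  by rewrite -(g0 (Ordinal l0)) // gE -val_eqE /=; lia.
have ginj : injective g by move=> i j /eqP; rewrite gE => /eqP.
have [g' gK1 gK2] : bijective g by exact: injF_bij.
by exists g'; [exists g | move=> u v; rewrite -Dg !gK2].
Qed.

(** * The comparison of D with B_{n,d} *)

Unset Implicit Arguments.
Set Strict Implicit.
Set Printing Implicit Defensive.

Theorem theorem4p2 (R : realType) (n d : nat) (D : rel 'I_n)
    (hd2 : (2 <= d)%N) (hdn : (d <= n - 1)%N)
    (D_simple : irreflexive D)
    (D_sc : strongly_connected D)
    (D_clique : clique_number D = d) :
  q R (@B n d) <= q R D /\ (q R D = q R (@B n d) <-> digraph_iso D (@B n d)).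
Proof.
have n0 : (0 < n)%N by lia.
have [K /forallP Kc cK] := max_clique D; rewrite D_clique in cK.
have KD u v : u \in K -> v \in K -> u != v -> D u v.
  by move=> uK vK; have /implyP/(_ uK)/forallP/(_ v)/implyP/(_ vK)/implyP := Kc u.
have [w0 w0K] : exists w0, w0 \in K by apply/card_gt0P; lia.
have [v0 v0K] : exists v0, v0 \notin K.
  have : (0 < #|~: K|)%N by rewrite cardsCs finset.setCK card_ord; lia.
  by move=> /card_gt0P[v]; rewrite inE; exists v.
have [w [v1 [wK v1K wv1]]] := exit_arc D_sc w0K v0K.
have [|h [h0 hS]] := @dist_to_set _ D K; first by move=> v; exists w.
pose m := (n - d)%N.
(* For v outside K this keeps m + 1 - h v between 1 and m, the range of the path equation. *)
have hm v : (h v <= m)%N.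
  have -> : m = #|~: K| by rewrite cardsCs finset.setCK card_ord cK.
  by apply: dist_le_card h0 _ v => u /hS[u' _ hu]; exists u'.
(* The default v is taken only inside K, where no vertex is closer. *)
pose phi v := odflt v [pick u | D v u && (h v == (h u).+1)].
have phiP v : v \notin K -> D v (phi v) /\ h v = (h (phi v)).+1.
  move=> /hS[u vu hu]; rewrite /phi; case: pickP => [u' /andP[a /eqP b]|/(_ u)] //.
  by rewrite vu hu eqxx.
have [X] := B_perron R hd2 hdn; rewrite -/m; set r := q R (@B n d).
set y := X (m + 1)%N => -[X0 Xp Xy ry rX0].
have Xlt k l : (0 < k)%N -> (k < l <= m.+1)%N -> X k < X l.
  move=> k0; elim: l => // l IH /andP[kl lm].
  have [_ Xl] := Xp l ltac:(lia).
  move: kl; rewrite ltnS leq_eqVlt => /orP[/eqP -> //|kl].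
  by apply: lt_trans Xl; apply: IH; lia.
(* The vertex u_{k+1} on the path is m + 1 - k arcs away from u_{n-d+2}, hence the index m + 1 -
   h. *)
pose z v := if v \in K then if v == w then X 0%N else y else X (m.+1 - h v)%N.
have z0 v : 0 < z v by rewrite /z /y; do 2?case: ifP => _; exact: X0.
have zw : z w = X 0%N by rewrite /z wK eqxx.
have zK v : v \in K -> v != w -> z v = y.
  by move=> vK /negbTE vw; rewrite /z vK vw.
pose M v j := if v \in K then (j \in K) && (j != v) || (v == w) && (j == v1)
              else j == phi v.
have MD v j : M v j -> D v j.
  rewrite /M; case: ifPn => [vK|vK /eqP ->]; last by have [] := phiP v vK.
  move=> /orP[/andP[jK jv]|/andP[/eqP -> /eqP -> //]].
  by apply: KD; rewrite // eq_sym.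
have zout v : v \notin K -> z v = X (m.+1 - h v)%N.
  by move=> /negbTE vK; rewrite /z vK.
(* Equality holds if [phi v] lies outside K or carries y; at w the value X_0 > y makes the
   inequality strict. *)
have Tout v : v \notin K ->
    r * z v <= z v + z (phi v) /\ (z v + z (phi v) <= r * z v -> phi v != w).
  move=> vK; have [_ hv] := phiP v vK; have hvm := hm v.
  have [rk _] := Xp (m.+1 - h v)%N ltac:(lia).
  rewrite (zout v vK) rk lerD2l lerD2l.
  have [pK|pK] := boolP (phi v \in K); last first.
    rewrite (zout _ pK); have -> : (m.+1 - h (phi v))%N = (m.+1 - h v).+1 by lia.
    by split=> // _; apply: contraNneq pK => ->.
  have hp : h (phi v) = 0%N by apply/eqP; rewrite h0.
  have -> : X (m.+1 - h v).+1 = y by rewrite /y; congr X; lia.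
  have [->|pw] := eqVneq (phi v) w; first by rewrite zw (ltW Xy) leNgt Xy.
  by rewrite zK // lexx.
have SK : \sum_(j in K) z j = X 0%N + (d%:R - 1) * y.
  by rewrite (sum_one_exception wK zK) zw cK.
have TK v : v \in K -> v != w -> \sum_(j | M v j) (z v + z j) = r * z v.
  move=> vK vw; rewrite (zK _ vK vw) ry -SK -cK -(zK _ vK vw) -(sum_clique z vK).
  by apply: eq_bigl => j; rewrite /M vK (negbTE vw) andFb orbF.
(* In B_{n,d} the arc leaving the clique leads to the value X_1; here it leads to X_{m+1-h(v1)},
   which is larger unless h v1 = m. *)
have Tw : r * z w <= \sum_(j | M w j) (z w + z j) /\
    (\sum_(j | M w j) (z w + z j) <= r * z w -> h v1 = m).
  have -> : \sum_(j | M w j) (z w + z j)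
      = (d%:R - 2) * z w + \sum_(j in K) z j + (z w + z v1).
    rewrite (bigD1 v1) /=; last by rewrite /M wK !eqxx orbT.
    rewrite -cK -(sum_clique z wK) addrC; congr (_ + _).
    apply: eq_bigl => j; rewrite /M wK eqxx.
    by have [->|_] := eqVneq j v1; rewrite ?(negbTE v1K) ?andbF ?orbF ?andbT.
  rewrite SK zw rX0 !lerD2l (zout _ v1K).
  have v1m := hm v1; have v1p : (0 < h v1)%N by rewrite lt0n h0.
  have [->|v1n] := eqVneq (h v1) m; first by rewrite subSnn lexx.
  have lt : X 1%N < X (m.+1 - h v1)%N by apply: Xlt => //; lia.
  by rewrite (ltW lt) leNgt lt.
have rT v : r * z v <= \sum_(j | M v j) (z v + z j).
  have [vK|vK] := boolP (v \in K); last first.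
    rewrite (big_pred1 (phi v)); first by have [] := Tout v vK.
    by move=> j; rewrite /M (negbTE vK).
  have [->|vw] := eqVneq v w; first by have [] := Tw.
  by rewrite TK.
have TD v := sum_sub_pred (fun j => addr_gt0 (z0 v) (z0 j)) (MD v).
pose u : 'cV[R]_n := \col_v z v.
have Qu v : (signless_laplacian R D *m u) v 0 = \sum_(j | D v j) (z v + z j).
  by rewrite signless_laplacian_mul; apply: eq_bigr => j _; rewrite !mxE.
have fu : feasible (signless_laplacian R D) r u.
  split=> [v||v]; first by rewrite mxE ltW.
    by apply/eqP => /colP /(_ w) /eqP; rewrite !mxE gt_eqF.
  by rewrite Qu mxE; apply: le_trans (rT v) _; have [] := TD v.
have [rq qeq] := q_ge n0 D_sc fu.
split; first exact: rq.
split=> [/qeq Eu|iso]; last first.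
  exact: (q_iso R n0 (B_strongly_connected hd2 hdn) iso).
have DT v : \sum_(j | D v j) (z v + z j) = r * z v.
  by rewrite -Qu Eu !mxE.
(* The kept arcs alone already reach r z_v, so by positivity of z no arc of D was dropped. *)
have DM v : forall j, D v j = M v j.
  by have [_] := TD v; apply; rewrite DT.
have TE v : \sum_(j | M v j) (z v + z j) <= r * z v.
  by rewrite -DT; have [] := TD v.
apply: (@B_iso n d D K w v1 h phi) => //.
- by have [_] := Tw; apply.
- move=> v vK; have [_ hv] := phiP v vK; split=> //.
    have [_] := Tout v vK; apply; have := TE v.
    by rewrite (big_pred1 (phi v)) // => j; rewrite /M (negbTE vK).
  by move=> j; rewrite DM /M (negbTE vK).
- by move=> v j vK vw; rewrite DM /M vK (negbTE vw) andFb orbF.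
- by move=> j; rewrite DM /M wK eqxx.
Qed.
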